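(* Let $(\mathfrak{h},[\cdot,\cdot]_{\mathfrak{h}})$ be a Lie algebra over $\mathbb{F}$, let $\mathfrak{a}$ be a vector space regarded as a trivial $\mathfrak{h}$-module, and let $\rho:\mathfrak{h}\to\mathfrak{gl}(\mathfrak{i})$ be a representation of $\mathfrak{h}$ on a vector space $\mathfrak{i}$. Let $\varphi:\mathfrak{h}\to\operatorname{Hom}(\mathfrak{a},\mathfrak{i})$ be a linear map that is a $1$-cocycle for the representation $\bar\rho:\mathfrak{h}\to\mathfrak{gl}(\operatorname{Hom}(\mathfrak{a},\mathfrak{i}))$, $\bar\rho(x)(\tau)=\rho(x)\circ\tau$. Consider the complex $C(\mathfrak{h};\mathfrak{a})\oplus C(\mathfrak{h};\mathfrak{i})$ with differential $\mathrm{d}_R(\lambda,\mu)=(\mathrm{d}_{\mathfrak{a}}(\lambda),\,e_\varphi(\lambda)+\mathrm{d}_\rho(\mu))$. For $(\lambda,\mu)\in C^2(\mathfrak{h};\mathfrak{a})\oplus C^2(\mathfrak{h};\mathfrak{i})$, let $[\cdot,\cdot]$ be the skew-symmetric bilinear map on $\mathfrak{h}\oplus\mathfrak{a}\oplus\mathfrak{i}$ defined by $$[x,y]=[x,y]_{\mathfrak{h}}+\lambda(x,y)+\mu(x,y),\qquad [x,u+\alpha]=\varphi(x)(u)+\rho(x)(\alpha),\qquad [u+\alpha,v+\beta]=0,$$ for all $x,y\in\mathfrak{h}$, $u,v\in\mathfrak{a}$, $\alpha,\beta\in\mathfrak{i}$. Then $[\cdot,\cdot]$ is a Lie bracket on $\mathfrak{h}\oplus\mathfrak{a}\oplus\mathfrak{i}$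 if and only if $\mathrm{d}_R(\lambda,\mu)=0$.
   Context: All algebras and vector spaces are finite dimensional over a field $\mathbb{F}$ of characteristic zero. For an $\mathfrak{h}$-module $V$ with representation $\rho$, $C^p(\mathfrak{h};V)$ is the space of alternating $p$-linear maps $\mathfrak{h}^p\to V$, and $C(\mathfrak{h};V)$ is the standard (Chevalley–Eilenberg) complex with differential $$\mathrm{d}_\rho(\mu)(x_1,\dots,x_{p+1})=\sum_{j=1}^{p+1}(-1)^{j-1}\rho(x_j)\big(\mu(x_1,\dots,\widehat{x_j},\dots,x_{p+1})\big)+\sum_{i<j}(-1)^{i+j}\mu([x_i,x_j]_{\mathfrak{h}},x_1,\dots,\widehat{x_i},\dots,\widehat{x_j},\dots,x_{p+1}).$$ $\mathrm{d}_{\mathfrak{a}}$ denotes this differential for the trivial module $\mathfrak{a}$ (only the second sum). That $\varphi$ is a $1$-cocycle for $\bar\rho$ means $\varphi([x,y]_{\mathfrak{h}})=\rho(x)\circ\varphi(y)-\rho(y)\circ\varphi(x)$ for all $x,y\in\mathfrak{h}$. The map $e_\varphi:C^p(\mathfrak{h};\mathfrak{a})\to C^{p+1}(\mathfrak{h};\mathfrak{i})$ is $$e_\varphi(\lambda)(x_1,\dots,x_{p+1})=\sum_{j=1}^{p+1}(-1)^{j-1}\varphi(x_j)\big(\lambda(x_1,\dots,\widehat{x_j},\dots,x_{p+1})\big).$$ *)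

(* Defs.v *)
From mathcomp Require Import all_boot all_order all_algebra.

Set Implicit Arguments.
Unset Strict Implicit.
Unset Printing Implicit Defensive.

Import GRing.Theory.
Local Open Scope ring_scope.

Definition is_bilinear (F : fieldType) (L M : lmodType F) (b : L -> L -> M) :
    Prop :=
  (forall x, linear (b x)) /\ (forall y, linear (fun x => b x y)).

Definition skew_symmetric (F : fieldType) (L M : lmodType F)
    (b : L -> L -> M) : Prop :=
  forall x y, b x y = - b y x.

Definition lie_bracket (F : fieldType) (L : lmodType F) (br : L -> L -> L) :
    Prop :=
  [/\ is_bilinear br,
      forall x, br x x = 0
    & forall x y z, br x (br y z) + br y (br z x) + br z (br x y) = 0].

Definition representation (F : fieldType) (h V : vectType F)
    (brh : h -> h -> h) (rho : {linear h -> 'End(V)}) : Prop :=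
  forall x y, rho (brh x y) = (rho x \o rho y)%VF - (rho y \o rho x)%VF.

Definition upd (T : Type) (p : nat) (x : p.-tuple T) (i : 'I_p) (v : T) :
    p.-tuple T :=
  [tuple if k == i then v else tnth x k | k < p].

Definition multilinear (F : fieldType) (h V : vectType F) (p : nat)
    (mu : p.-tuple h -> V) : Prop :=
  forall (i : 'I_p) (x : p.-tuple h), linear (fun v => mu (upd x i v)).

Definition alternating (F : fieldType) (h V : vectType F) (p : nat)
    (mu : p.-tuple h -> V) : Prop :=
  forall (x : p.-tuple h) (i j : 'I_p),
    i != j -> tnth x i = tnth x j -> mu x = 0.

Record cochain (F : fieldType) (h V : vectType F) (p : nat) := Cochain {
  cochain_fun :> p.-tuple h -> V;
  cochain_multilinear : multilinear cochain_fun;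
  cochain_alternating : alternating cochain_fun
}.

(* (x_1, .., ^x_j, .., x_(p+1)) *)
Definition omit (T : Type) (p : nat) (x : p.+1.-tuple T) (j : 'I_p.+1) :
    p.-tuple T :=
  [tuple tnth x (lift j k) | k < p].

(* (y, x_1, .., ^x_i, .., ^x_j, .., x_(p+1)) for i < j.  The m-th index        *)
(* (from 0) remaining after i and j are removed is bump j (bump i m); it is at *)
(* most p for every m < p.-1, so that inord does not truncate it.              *)
Definition cons_omit2 (T : Type) (p : nat) (y : T) (x : p.+1.-tuple T)
    (i j : 'I_p.+1) : p.-tuple T :=
  [tuple if k == 0%N :> nat then y
         else tnth x (inord (bump j (bump i k.-1))) | k < p].

(* Indices start from 0: the sign (-1)^(j-1) becomes (-1) ^+ j, and            *)
(* (-1)^(i+j) is unchanged.                                                    *)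
Definition ce_diff (F : fieldType) (h V : vectType F) (brh : h -> h -> h)
    (rho : h -> 'End(V)) (p : nat) (mu : p.-tuple h -> V) :
    p.+1.-tuple h -> V :=
  fun x =>
    \sum_(j < p.+1) (-1) ^+ j *: rho (tnth x j) (mu (omit x j))
    + \sum_(i < p.+1) \sum_(j < p.+1 | (i < j)%N)
        (-1) ^+ (i + j) *: mu (cons_omit2 (brh (tnth x i) (tnth x j)) x i j).

Definition trivial_rep (F : fieldType) (h V : vectType F) : h -> 'End(V) :=
  fun _ => 0.

Definition e_map (F : fieldType) (h a i : vectType F)
    (phi : h -> 'Hom(a, i)) (p : nat) (lam : p.-tuple h -> a) :
    p.+1.-tuple h -> i :=
  fun x => \sum_(j < p.+1) (-1) ^+ j *: phi (tnth x j) (lam (omit x j)).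

Definition rho_bar (F : fieldType) (h a i : vectType F) (rho : h -> 'End(i))
    (x : h) (tau : 'Hom(a, i)) : 'Hom(a, i) :=
  (rho x \o tau)%VF.

Definition cocycle1 (F : fieldType) (h M : vectType F) (brh : h -> h -> h)
    (act : h -> M -> M) (f : h -> M) : Prop :=
  forall x y, f (brh x y) = act x (f y) - act y (f x).

Definition d_R (F : fieldType) (h a i : vectType F) (brh : h -> h -> h)
    (rho : h -> 'End(i)) (phi : h -> 'Hom(a, i)) (p : nat)
    (lm : (p.-tuple h -> a) * (p.-tuple h -> i)) :
    (p.+1.-tuple h -> a) * (p.+1.-tuple h -> i) :=
  (ce_diff brh (@trivial_rep F h a) lm.1,
   fun x => e_map phi lm.1 x + ce_diff brh rho lm.2 x).

(* The elements of h (+) a (+) i are triples (x, u, alpha).  The lemmas below  *)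
(* show that this is the skew-symmetric bilinear map with the prescribed       *)
(* values on h x h, h x (a (+) i) and (a (+) i) x (a (+) i).                   *)
Definition ext_bracket (F : fieldType) (h a i : vectType F)
    (brh : h -> h -> h) (rho : h -> 'End(i)) (phi : h -> 'Hom(a, i))
    (lam : 2.-tuple h -> a) (mu : 2.-tuple h -> i) (X Y : h * a * i) :
    h * a * i :=
  let: (x, u, alpha) := X in
  let: (y, v, beta) := Y in
  (brh x y,
   lam [tuple x; y],
   mu [tuple x; y] + (phi x v + rho x beta) - (phi y u + rho y alpha)).

Section ExtBracket.
Variables (F : fieldType) (h a i : vectType F) (brh : h -> h -> h).
Variables (rho : {linear h -> 'End(i)}) (phi : {linear h -> 'Hom(a, i)}).
Variables (lam : cochain h a 2) (mu : cochain h i 2).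
Hypothesis brhP : lie_bracket brh.
Local Notation br := (ext_bracket brh rho phi lam mu).

Lemma ext_bracket_hh x y :
  br (x, 0, 0) (y, 0, 0) = (brh x y, lam [tuple x; y], mu [tuple x; y]).
Proof. by rewrite /= !linear0 !addr0 subr0. Qed.

Lemma cochain2_linr (V : vectType F) (m : cochain h V 2) x :
  linear (fun y => m [tuple x; y]).
Proof.
move=> c y z.
have E v : [tuple x; v] = upd [tuple x; x] ord_max v.
  by apply: eq_from_tnth => k; rewrite tnth_mktuple; case: k => [[|[|[]]] ?].
by rewrite (E (c *: y + z)) (E y) (E z) cochain_multilinear.
Qed.

Lemma cochain2_linl (V : vectType F) (m : cochain h V 2) y :
  linear (fun x => m [tuple x; y]).
Proof.
move=> c x z.
have E v : [tuple v; y] = upd [tuple y; y] ord0 v.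
  by apply: eq_from_tnth => k; rewrite tnth_mktuple; case: k => [[|[|[]]] ?].
by rewrite (E (c *: x + z)) (E x) (E z) cochain_multilinear.
Qed.

Lemma cochain2_alt (V : vectType F) (m : cochain h V 2) x :
  m [tuple x; x] = 0.
Proof. exact: (@cochain_alternating _ _ _ _ m _ ord0 ord_max). Qed.

Lemma bilinear_alt_skew (L M : lmodType F) (b : L -> L -> M) :
  is_bilinear b -> (forall x, b x x = 0) -> skew_symmetric b.
Proof.
move=> [lr ll] b0 x y; apply/eqP; rewrite -addr_eq0; apply/eqP.
have := b0 (1 *: x + y).
by rewrite ll !lr !b0 !scale1r add0r addr0.
Qed.

Lemma cochain2_bilinear (V : vectType F) (m : cochain h V 2) :
  is_bilinear (fun x y => m [tuple x; y]).
Proof. by split=> x; [apply: cochain2_linr | apply: cochain2_linl]. Qed.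

Lemma ext_bracket_ha x u alpha :
  br (x, 0, 0) (0, u, alpha) = (0, 0, phi x u + rho x alpha).
Proof.
have Z (L M : lmodType F) (b : L -> L -> M) z : is_bilinear b -> b z 0 = 0.
  by case=> lr _; have := lr z (-1) 0 0; rewrite !scaleN1r oppr0 addr0 addNr.
rewrite /= !(Z _ _ _ _ (cochain2_bilinear _)) Z; last by case: brhP.
by rewrite !linear0 add0r addr0 subr0.
Qed.

Lemma ext_bracket_aa u alpha v beta :
  br (0, u, alpha) (0, v, beta) = (0, 0, 0).
Proof.
case: brhP => _ b0 _.
by rewrite /= b0 !cochain2_alt !linear0 !lfunE /= !addr0 subr0.
Qed.

Lemma ext_bracket_skew : skew_symmetric br.
Proof.
move=> [[x u] al] [[y v] be] /=.
case: brhP => /bilinear_alt_skew bs b0 _.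
rewrite (bs b0 x y).
rewrite (bilinear_alt_skew (cochain2_bilinear lam) (cochain2_alt lam) x y).
rewrite (bilinear_alt_skew (cochain2_bilinear mu) (cochain2_alt mu) x y).
have E (m p q : i) : - m + p - q = - (m + q - p).
  by rewrite opprB opprD addrCA addrA.
by congr (_, _, _); apply: E.
Qed.

Lemma ext_bracket_bilinear : is_bilinear br.
Proof.
have R X : linear (br X).
  case: X => [[x u] al] c [[y v] be] [[z w] ga] /=.
  case: brhP => -[lr _] _ _.
  rewrite lr !cochain2_linr; congr (_, _, _).
  have E (m m' p p' q q' r r' s s' : i) :
      c *: m + m' + (c *: p + p' + (c *: q + q'))
        - (c *: r + r' + (c *: s + s'))
      = c *: (m + (p + q) - (r + s)) + (m' + (p' + q') - (r' + s')).
    rewrite scalerBr !scalerDr (addrACA (c *: p)) (addrACA (c *: r)).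
    by rewrite (addrACA (c *: m)) (opprD (_ + _)) [LHS]addrACA.
  rewrite !linearP !add_lfunE !scale_lfunE; exact: E.
split=> // Y c X Z.
by rewrite ext_bracket_skew R (ext_bracket_skew X) (ext_bracket_skew Z)
   scalerN opprD.
Qed.

End ExtBracket.

(* Main.v *)
Require Import Defs.
From mathcomp Require Import all_boot all_order all_algebra.

Set Implicit Arguments.
Unset Strict Implicit.
Unset Printing Implicit Defensive.

Import GRing.Theory.
Local Open Scope ring_scope.

(** The bracket is always bilinear and alternating, so being a Lie bracket
    amounts to the Jacobi identity.  The Jacobiator of (x, u, alpha),
    (y, v, beta), (z, w, gamma) is computed in [jacobiator_ext_bracket]: its
    h-component is the Jacobiator of h, hence 0, and its other two components
    are d_R (lambda, mu) evaluated at (x, y, z).  Indeed, once the alternating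
    sums over three arguments are written as cyclic sums ([e_map3],
    [ce_diff3]), the terms involving lambda and mu are literally those of d_R.
    The remaining terms come from the operators
    T_x (u, alpha) = phi(x)(u) + rho(x)(alpha), which satisfy
    T_[x,y] = rho(x) T_y - rho(y) T_x exactly because phi is a cocycle and rho
    a representation ([act_bracket]); with this their cyclic sum vanishes.
    As x, y, z are arbitrary, the equivalence follows. *)

Section CyclicFormulas.
Variables (F : fieldType) (h : vectType F) (brh : h -> h -> h).

Lemma cochain2_skew (V : vectType F) (m : cochain h V 2) x y :
  m [tuple x; y] = - m [tuple y; x].
Proof. exact: bilinear_alt_skew (cochain2_bilinear m) (cochain2_alt m) x y. Qed.

Lemma cochain2Nr (V : vectType F) (m : cochain h V 2) x y :
  m [tuple x; - y] = - m [tuple x; y].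
Proof.
have m0 : m [tuple x; 0] = 0.
  by have := cochain2_linr m x (-1) y y; rewrite !scaleN1r !addNr.
by have := cochain2_linr m x (-1) y 0; rewrite !scaleN1r m0 !addr0.
Qed.

(** Over three arguments the alternating sum is cyclic, m being alternating.
    The same expression is the first sum of the Chevalley-Eilenberg differential
    when V = W. *)
Lemma e_map3 (V W : vectType F) (f : h -> 'Hom(V, W)) (m : cochain h V 2)
    x y z :
  e_map f m [tuple x; y; z]
  = f x (m [tuple y; z]) + f y (m [tuple z; x]) + f z (m [tuple x; y]).
Proof.
have omit0 : omit [tuple x; y; z] ord0 = [tuple y; z].
  by apply: eq_from_tnth => k; rewrite tnth_mktuple; case: k => [[|[|[]]] ?].
have omit1 : omit [tuple x; y; z] (lift ord0 ord0) = [tuple x; z].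
  by apply: eq_from_tnth => k; rewrite tnth_mktuple; case: k => [[|[|[]]] ?].
have omit2 : omit [tuple x; y; z] (lift ord0 (lift ord0 ord0)) = [tuple x; y].
  by apply: eq_from_tnth => k; rewrite tnth_mktuple; case: k => [[|[|[]]] ?].
rewrite /e_map !big_ord_recl big_ord0 addr0 omit0 omit1 omit2.
rewrite /= expr0 scale1r expr1 scaleN1r sqrrN expr1n scale1r.
by rewrite (cochain2_skew m z x) linearN addrA.
Qed.

Lemma ce_diff3 (V : vectType F) (r : h -> 'End(V)) (m : cochain h V 2) x y z :
  lie_bracket brh ->
  ce_diff brh r m [tuple x; y; z]
  = e_map r m [tuple x; y; z]
    + (m [tuple x; brh y z] + m [tuple y; brh z x] + m [tuple z; brh x y]).
Proof.
case=> brh_bil brh_alt _; rewrite /ce_diff; congr (_ + _).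
have tn k : (k < 3)%N -> tnth [tuple x; y; z] (inord k) = nth 0 [:: x; y; z] k.
  by move=> ltk3; rewrite (tnth_nth 0) inordK.
have co (i j : 'I_3) u : (bump j (bump i 0) < 3)%N ->
    cons_omit2 u [tuple x; y; z] i j
    = [tuple u; nth 0 [:: x; y; z] (bump j (bump i 0))].
  move=> lt3; apply: eq_from_tnth => k; rewrite tnth_mktuple.
  by case: k => [[|[|[]]] ?] //=; rewrite tn.
under eq_bigr do rewrite big_mkcond /=.
rewrite !big_ord_recl !big_ord0 /= !addr0 !add0r !co //=.
(* The three pairs i < j contribute with signs -1, 1 and -1. *)
transitivity (- m [tuple brh x y; z] + m [tuple brh x z; y]
              - m [tuple brh y z; x]).
  congr (_ + _ + _); first exact: scaleN1r.
    by rewrite -signr_odd scale1r.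
  by rewrite -signr_odd scaleN1r.
rewrite -!cochain2_skew (bilinear_alt_skew brh_bil brh_alt x z).
rewrite (cochain2_skew m _ y) cochain2Nr opprK.
by rewrite [LHS](ACl (3*2*1))%AC.
Qed.

End CyclicFormulas.

(** The cancellation behind the vanishing of the cyclic sum of the action terms. *)
Lemma cyclic_sum_cancel (V : zmodType) (p q r s t w : V) :
  (p - q - (r - s)) + (r - t - (w - q)) + (w - s - (p - t)) = 0.
Proof.
rewrite !opprB !addrA.
rewrite [LHS](ACl ((1*12)*(7*2)*(3*10)*(5*4)*(11*6)*(9*8)))%AC /=.
by rewrite !subrr !addr0.
Qed.

Section Extension.
Variables (F : fieldType) (h a i : vectType F) (brh : h -> h -> h).
Hypothesis brhP : lie_bracket brh.
Variables (rho : {linear h -> 'End(i)}) (phi : {linear h -> 'Hom(a, i)}).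
Hypotheses (rhoP : representation brh rho)
           (phiP : cocycle1 brh (rho_bar rho) phi).
Variables (lam : cochain h a 2) (mu : cochain h i 2).
Local Notation br := (ext_bracket brh rho phi lam mu).
Local Notation dR := (d_R brh rho phi (cochain_fun lam, cochain_fun mu)).

(** The operators T_x (u, alpha) = phi(x)(u) + rho(x)(alpha) by which h acts on
    a (+) i; they take values in i. *)
Definition ext_act (x : h) (n : a * i) : i := phi x n.1 + rho x n.2.
Local Notation T := ext_act.

(** T is a Lie action of h, since T_x T_y = rho(x) T_y: the a-part is
    the cocycle condition, the i-part the representation property. *)
Lemma act_bracket x y n : T (brh x y) n = rho x (T y n) - rho y (T x n).
Proof.
rewrite /ext_act phiP rhoP /rho_bar !add_lfunE !opp_lfunE !comp_lfunE.
by rewrite (linearD (rho x)) (linearD (rho y)) opprD addrACA.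
Qed.

(** The h-components of the arguments are the only ones that survive in the
    Jacobiator. *)
Lemma jacobiator_ext_bracket X Y Z :
  br X (br Y Z) + br Y (br Z X) + br Z (br X Y)
  = (0, dR.1 [tuple X.1.1; Y.1.1; Z.1.1], dR.2 [tuple X.1.1; Y.1.1; Z.1.1]).
Proof.
case: X Y Z => [[x u] al] [[y v] be] [[z w] ga].
have [_ _ jac] := brhP.
rewrite /d_R /= !ce_diff3 //; congr (_, _, _) => /=; first exact: jac.
  by rewrite [X in _ = X + _]e_map3 !lfunE /= !addr0 add0r.
rewrite !e_map3.
(* Each double bracket is its part in lambda and mu plus its action part. *)
have split_term x' y' z' u' v' w' al' be' ga' :
    mu [tuple x'; brh y' z'] + (phi x' (lam [tuple y'; z'])
      + rho x' (mu [tuple y'; z'] + (phi y' w' + rho y' ga')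
                - (phi z' v' + rho z' be')))
      - (phi (brh y' z') u' + rho (brh y' z') al')
    = (phi x' (lam [tuple y'; z']) + rho x' (mu [tuple y'; z'])
       + mu [tuple x'; brh y' z'])
      + (rho x' (T y' (w', ga')) - rho x' (T z' (v', be'))
         - (rho y' (T z' (u', al')) - rho z' (T y' (u', al')))).
  rewrite -act_bracket -addrA (linearB (rho x')) (linearD (rho x')) /ext_act /=.
  by rewrite !addrA [LHS](ACl (2*3*1*4*5*6))%AC.
rewrite !split_term.
rewrite [X in X + _ = _]addrACA [LHS]addrACA cyclic_sum_cancel addr0.
by rewrite [LHS](AC (3*3*3) ((1*4*7)*((2*5*8)*(3*6*9))))%AC.
Qed.

End Extension.

Theorem proposition1p1 (F : fieldType) (charF0 : [pchar F] =i pred0)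
    (h a i : vectType F) (brh : h -> h -> h) (brhP : lie_bracket brh)
    (rho : {linear h -> 'End(i)}) (rhoP : representation brh rho)
    (phi : {linear h -> 'Hom(a, i)}) (phiP : cocycle1 brh (rho_bar rho) phi)
    (lam : cochain h a 2) (mu : cochain h i 2) :
  lie_bracket (ext_bracket brh rho phi lam mu) <->
  (d_R brh rho phi (cochain_fun lam, cochain_fun mu)).1 =1 \0 /\
  (d_R brh rho phi (cochain_fun lam, cochain_fun mu)).2 =1 \0.
Proof.
have jacE := jacobiator_ext_bracket brhP rhoP phiP lam mu.
split=> [[_ _ jac] | [d1 d2]].
  suff dR0 t : (d_R brh rho phi (cochain_fun lam, cochain_fun mu)).1 t = 0 /\
               (d_R brh rho phi (cochain_fun lam, cochain_fun mu)).2 t = 0.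
    by split=> t; have [] := dR0 t.
  have -> : t = [tuple tnth t ord0; tnth t (inord 1); tnth t (inord 2)].
    apply: eq_from_tnth => k; rewrite [RHS](tnth_nth 0).
    by case: k => [[|[|[|]]] //= ?]; congr tnth; apply: val_inj;
       rewrite //= inordK.
  have := jacE (tnth t ord0, 0, 0) (tnth t (inord 1), 0, 0)
               (tnth t (inord 2), 0, 0).
  by rewrite jac => -[d1 d2]; split; apply: esym.
split; first exact: ext_bracket_bilinear.
  move=> [[x u] al] /=; have [_ b0 _] := brhP.
  by rewrite b0 !cochain2_alt add0r subrr.
by move=> X Y Z; rewrite jacE d1 d2.
Qed.
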